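(* Let $k,n$ be positive integers and $\varepsilon=\exp(2\pi\sqrt{-1}/k)$. Let $A,T\in Mat_n(\mathbb{C})$ satisfy $A^k=\mathbf 1$, $AT=\varepsilon\,TA$, and suppose $T^k-\mathbf 1$ is invertible. Put $$B=(\varepsilon T-\mathbf 1)(T-\mathbf 1)^{-1}A,\qquad C=T(T-\mathbf 1)^{-1},$$ and let $\circ$ be the multiplication on $Mat_n(\mathbb{C})$ given by $$X\circ Y=R(X)Y+XR(Y)-R(XY),\qquad R(x)=\sum_{i=1}^{k-1}\frac{1}{\varepsilon^i-1}A^{k-i}\,x\,B^i+C\,x .$$ Let $\mu=\mu(\lambda)=\left(\frac{2+(k+1)\lambda}{2-(k-1)\lambda}\right)^{1/k}$, with the branch such that $\mu(0)=1$. Then: (a) The operator $$S_\lambda(x)=\sum_{i=0}^{k-1}P_i\,x\,B^i,\qquad P_i=\frac{\lambda}{\varepsilon^i\mu-1}(\mu T-\mathbf 1)(T-\mathbf 1)^{-1}A^{k-i},$$ has the form $S_\lambda=\mathbf 1+R\,\lambda+O(\lambda^2)$ and satisfies $$S_\lambda(X)\,S_\lambda(Y)=S_\lambda\big(XY+\lambda\,X\circ Y\big)\qquad\text{for all }X,Y\in Mat_n(\mathbb{C}).$$ (b) The inverse operator is $$S_\lambda^{-1}(x)=\sum_{i=0}^{k-1}Q_i\,x\,B^i,\qquad Q_i=\frac{(\mu^k-1)^2}{\lambda k^2\mu^{k-1}(\mu-\varepsilon^i)}(\varepsilon^{k-i}T-\mathbf 1)(\varepsilon^{k-i}\mu T-\mathbf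 1)^{-1}A^{k-i}.$$ (c) The Lax operator $L(x)=(S_\lambda^{-1})^*(x)$ is $$L(x)=\sum_{i=0}^{k-1}B^i\,x\,Q_i .$$
   Context: $Mat_n(\mathbb{C})$ is the algebra of complex $n\times n$ matrices and $\mathbf 1$ denotes the identity (matrix or operator). For a linear operator $Q$ on $Mat_n(\mathbb{C})$, the adjoint $Q^*$ is taken with respect to the bilinear form $\mathrm{trace}(xy)$, i.e. $\mathrm{trace}(Q(x)y)=\mathrm{trace}(x\,Q^*(y))$ for all $x,y$. The operator-valued function $S_\lambda$ and its inverse are considered as power series in $\lambda$ (equivalently, as analytic functions for $\lambda$ in a sufficiently small neighbourhood of $0$, where the formulas are understood at $\lambda=0$ by removing the removable singularity). *)

(* Defs.v *)
(* MathComp with MathComp-Analysis. *)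
From mathcomp Require Import all_boot all_order all_algebra.
From mathcomp Require Import complex.
From mathcomp Require Import all_classical all_reals all_analysis.

Set Implicit Arguments.
Unset Strict Implicit.
Unset Printing Implicit Defensive.

Import Order.TTheory GRing.Theory Num.Theory.
Import numFieldTopology.Exports numFieldNormedType.Exports.

Local Open Scope classical_set_scope.
Local Open Scope complex_scope.
Local Open Scope ring_scope.

(* Packaging R[i] as a numFieldType gives it the topology and the normed
   space structure that MathComp-Analysis puts on every such field (those of
   the modulus); the library has no instance for the bare type R[i]. *)
Definition Cx (R : realType) : numFieldType := R[i].

Definition cexp (R : realType) (z : R[i]) : Cx R :=
  let: x +i* y := z in (expR x)%:C * (cos y +i* sin y).

Section Operators.
Variables (K : numFieldType) (k n : nat) (eps : K) (A T : 'M[K]_n).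

(* The sums below use A ^+ (k - i) and eps ^+ (k - i) for i < k only, so the
   natural-number subtraction is never truncated. *)

Definition Bmx : 'M[K]_n := (eps *: T - 1%:M) *m invmx (T - 1%:M) *m A.

Definition Cmx : 'M[K]_n := T *m invmx (T - 1%:M).

Definition Rop (x : 'M[K]_n) : 'M[K]_n :=
  \sum_(1 <= i < k) (eps ^+ i - 1)^-1 *: (A ^+ (k - i) *m x *m Bmx ^+ i)
  + Cmx *m x.

Definition circ (X Y : 'M[K]_n) : 'M[K]_n :=
  Rop X *m Y + X *m Rop Y - Rop (X *m Y).

(* "mu is the k-th root of (2+(k+1)l)/(2-(k-1)l) with mu(0) = 1". The two lemmas
   after this section show that such a mu exists and that its values near 0 are
   uniquely determined; as usual for a branch, values away from 0 are free. *)
Definition root_branch (mu : K -> K) : Prop :=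
  [/\ mu 0 = 1,
      {for 0, continuous mu} &
      \forall l \near (0 : K),
        mu l ^+ k = (2 + (k%:R + 1) * l) / (2 - (k%:R - 1) * l)].

(* f with its singularity at 0 removed. In the coefficients below the 0/0 at
   l = 0 occurs only in the scalar factor; the matrix factors are evaluated
   at mu(0) = 1 directly. *)
Definition remove_sing (f : K -> K) (l : K) : K :=
  if l == 0 then lim (f @ 0^') else f l.

Definition is_inverse (S V : 'M[K]_n -> 'M[K]_n) : Prop :=
  cancel S V /\ cancel V S.

Definition is_adjoint (Q Q' : 'M[K]_n -> 'M[K]_n) : Prop :=
  forall x y, \tr (Q x *m y) = \tr (x *m Q' y).

Variable mu : K -> K.

Definition Pmx (l : K) (i : nat) : 'M[K]_n :=
  remove_sing (fun l => l / (eps ^+ i * mu l - 1)) l *: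
    ((mu l *: T - 1%:M) *m invmx (T - 1%:M) *m A ^+ (k - i)).

Definition Sop (l : K) (x : 'M[K]_n) : 'M[K]_n :=
  \sum_(0 <= i < k) Pmx l i *m x *m Bmx ^+ i.

Definition Qmx (l : K) (i : nat) : 'M[K]_n :=
  remove_sing (fun l => (mu l ^+ k - 1) ^+ 2 /
      (l * k%:R ^+ 2 * mu l ^+ (k - 1) * (mu l - eps ^+ i))) l *:
    ((eps ^+ (k - i) *: T - 1%:M)
     *m invmx ((eps ^+ (k - i) * mu l) *: T - 1%:M) *m A ^+ (k - i)).

End Operators.

Section RootBranch.

Let affine_continuous (F : numFieldType) (a b : F) :
  continuous (fun l : F => a + b * l).
Proof.
move=> x; apply: continuousD; first exact: cst_continuous.
by apply: continuousM; [exact: cst_continuous | exact: (@cvg_id)].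
Qed.

Let continuous_atP (F : numFieldType) (f : F -> F) (x : F) :
  {for x, continuous f} <->
  forall e, 0 < e -> \forall l \near x, `|f x - f l| < e.
Proof. exact: (@cvgrPdist_lt _ _ _ (nbhs x)). Qed.

Let exp_continuous (F : numFieldType) (f : F -> F) (x : F) m :
  {for x, continuous f} -> {for x, continuous (fun l => f l ^+ m)}.
Proof.
move=> fc; elim: m => [|m IH]; first exact: cst_continuous.
have -> : (fun l => f l ^+ m.+1) = f \* (fun l => f l ^+ m).
  by apply/funext => l; rewrite exprS.
exact: continuousM.
Qed.

Let homogeneous_sum_continuous (F : numFieldType) (f g : F -> F) (x : F) m :
  {for x, continuous f} -> {for x, continuous g} ->
  {for x, continuous (fun l => \sum_(i < m) f l ^+ (m.-1 - i) * g l ^+ i)}.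
Proof.
move=> fc gc; rewrite /index_enum; elim: (Finite.enum _) => [|i s IH].
  have -> : (fun l : F => \sum_(i <- [::] : seq 'I_m) f l ^+ (m.-1 - i) * g l ^+ i)
            = cst 0 by apply/funext => l; rewrite big_nil.
  exact: cst_continuous.
have -> : (fun l => \sum_(j <- i :: s) f l ^+ (m.-1 - j) * g l ^+ j) =
    (fun l => f l ^+ (m.-1 - i) * g l ^+ i)
    \+ (fun l => \sum_(j <- s) f l ^+ (m.-1 - j) * g l ^+ j).
  by apply/funext => l; rewrite big_cons.
apply: continuousD => //.
by apply: (@continuousM _ _ (fun l => f l ^+ (m.-1 - i)));
  exact: exp_continuous.
Qed.

Let near_root (K : numClosedFieldType) (k : nat) (w : K) : (0 < k)%N ->
  exists r : K, r ^+ k = w /\ `|1 - r| ^+ k <= `|1 - w|.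
Proof.
move=> k_gt0; pose p : {poly K} := 'X^k - w%:P.
have [s sE] := closed_field_poly_normal p.
have lp : lead_coef p = 1 by rewrite lead_coefXnsubC.
rewrite lp scale1r in sE.
have szs : size s = k.
  by have := size_XnsubC w k_gt0; rewrite -/p sE size_prod_XsubC; case.
have rk r : r \in s -> r ^+ k = w.
  rewrite -root_prod_XsubC -sE => /rootP; rewrite /p !hornerE => /eqP.
  by rewrite subr_eq0 => /eqP.
have H1 : `|1 - w| = \prod_(0 <= i < k) `|1 - nth 0 s i|.
  have := congr1 (fun q : {poly K} => `|q.[1]|) sE.
  rewrite /p !hornerE expr1n => ->; rewrite horner_prod normr_prod.
  rewrite (big_nth 0) szs.
  by apply: eq_bigr => r _; rewrite !hornerE.
have [/hasP[r rs hr]|/hasPn h] :=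
    boolP (has (fun r => `|1 - r| ^+ k <= `|1 - w|) s).
  by exists r; rewrite rk.
exfalso; have : `|1 - w| ^+ k < `|1 - w| ^+ k; last by rewrite ltxx.
rewrite [ltRHS](congr1 (fun x => x ^+ k) H1) -prodrXl.
rewrite -[in ltLHS](subn0 k) -prodr_const_nat.
apply: ltr_prod_nat => // i /andP[_ ik]; rewrite normr_ge0 /=.
have /h : nth 0 s i \in s by rewrite mem_nth // szs.
by rewrite -real_ltNge // ?realX ?normr_real.
Qed.

Lemma root_branch_exists (R : realType) (k : nat) : (0 < k)%N ->
  exists mu : Cx R -> Cx R, root_branch k mu.
Proof.
set K := Cx R => k_gt0.
have [f fP] := boolp.choice (fun w : R[i] => near_root w k_gt0).
pose w (l : K) : K := (2 + (k%:R + 1) * l) / (2 - (k%:R - 1) * l).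
have w0 : w 0 = 1 by rewrite /w !mulr0 addr0 subr0 divff // pnatr_eq0.
have wc : {for 0, continuous w}.
  apply: (@continuousM _ _ (fun l : K => 2 + (k%:R + 1) * l)).
    exact: affine_continuous.
  apply: (@continuousV _ _ (fun l : K => 2 - (k%:R - 1) * l)).
    by rewrite mulr0 subr0 pnatr_eq0.
  have -> : (fun l : K => 2 - (k%:R - 1) * l) = fun l => 2 + (1 - k%:R) * l.
    by apply/funext => l; rewrite -mulNr opprB.
  exact: affine_continuous.
have f1 : f (w 0) = 1.
  have [_] := fP (w 0); rewrite w0 subrr normr0 => h.
  apply/esym/eqP; rewrite -subr_eq0 -normr_eq0.
  have : `|1 - f 1| ^+ k == 0 by rewrite eq_le h exprn_ge0.
  by rewrite expf_eq0 => /andP[].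
exists (f \o w); split => [||]; [exact: f1 | | by apply: filterE => l; have [] := fP (w l)].
apply/continuous_atP => e e0.
have ek : 0 < e ^+ k by rewrite exprn_gt0.
have {}wc : \forall l \near (0 : K), `|w 0 - w l| < e ^+ k.
  by move/continuous_atP : wc; apply.
apply: filterS wc => l wl; have [_ h] := fP (w l).
rewrite [(f \o w) 0]f1 -(@ltr_pXn2r _ k) ?nnegrE ?normr_ge0 ?(ltW e0) //.
by apply: le_lt_trans h _; rewrite -w0.
Qed.

Lemma root_branch_unique (K : numFieldType) (k : nat) (mu nu : K -> K) :
  (0 < k)%N -> root_branch k mu -> root_branch k nu -> \forall l \near (0 : K), mu l = nu l.
Proof.
move=> k_gt0 [mu0 muc muE] [nu0 nuc nuE].
pose g (l : K) : K := \sum_(i < k) mu l ^+ (k.-1 - i) * nu l ^+ i.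
have gc : {for 0, continuous g}.
  exact: homogeneous_sum_continuous.
have g0 : g 0 != 0.
  rewrite /g mu0 nu0 (eq_bigr (fun=> 1)) => [|i _]; last by rewrite !expr1n mulr1.
  by rewrite sumr_const card_ord pnatr_eq0 -lt0n.
have gn : \forall l \near (0 : K), g l != 0.
  have /continuous_atP /(_ `|g 0|) := gc; rewrite normr_gt0 => /(_ g0).
  apply: filterS => l; apply: contraTneq => ->.
  by rewrite subr0 ltxx.
apply: filterS3 gn muE nuE => l gl mul nul.
have : (mu l - nu l) * g l = 0.
  rewrite -subrXX; apply/eqP; rewrite subr_eq0; apply/eqP.
  by rewrite mul nul.
move=> /eqP; rewrite mulf_eq0 (negPf gl) orbF subr_eq0.
by move=> /eqP.
Qed.

End RootBranch.

(* Main.v *)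
(* For a = A^-1 and D = (T - 1)^-1 the relation AT = eps TA gives
   B^i = (eps^i + (eps^i - 1) D) A^i, so that B^k = 1 and every operator involved
   is a sum over i in Z/k of terms h(T) a^i x B^i.  Expanding both sides of the
   identity for S(X) S(Y) in the terms
     (mu T - 1) D a^i X (alpha + beta D) a^(j-i) Y B^j
   and comparing coefficients leaves partial fractions in mu and the roots of
   unity; the terms with i = j use the defining relation of mu in the form
   1/l = k/(mu^k - 1) + (k - 1)/2.  With M = (mu T - 1) D one has
   S(x) = M sum_i p_i a^i x B^i and the proposed inverse is
   sum_j q_j a^j M^-1 x B^j; these are mutually inverse because the cyclic
   convolution of p and q is the unit: off the unit its values vanish by partial
   fractions, so the remaining value is (sum_i p_i) (sum_j q_j) = 1. *)
Require Import Defs.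
From mathcomp Require Import all_boot all_order all_algebra.
From mathcomp Require Import complex ring lra.
From mathcomp Require Import all_classical all_reals all_analysis.

Set Implicit Arguments.
Unset Strict Implicit.
Unset Printing Implicit Defensive.

Import Order.TTheory GRing.Theory Num.Theory.
Import numFieldTopology.Exports numFieldNormedType.Exports.

Local Open Scope classical_set_scope.
Local Open Scope complex_scope.
Local Open Scope ring_scope.

(** * Sums over the roots of unity *)

(** A full period may start anywhere: raising the offset from [m] to [m + 1] trades [f m] for
    [f (m + k)]. Sums over Z/k are reindexed in this way. *)
Lemma sum_shift (V : nmodType) (k : nat) (f : nat -> V) (m : nat) :
  (forall i, f (i + k)%N = f i) ->
  \sum_(0 <= i < k) f (i + m)%N = \sum_(0 <= i < k) f i.
Proof.
move=> fk; elim: m => [|m IHm]; first by under eq_bigr do rewrite addn0.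
rewrite -IHm; case: k fk {IHm} => [|k] fk; first by rewrite !big_geq.
rewrite big_nat_recr //= [RHS]big_nat_recl //= addrC add0n.
by rewrite addnS -addSn addnC fk; under eq_bigr do rewrite addnS -addSn.
Qed.

Section RootsOfUnity.
Variables (K : numFieldType) (k : nat) (eps : K).
Hypothesis epsP : k.-primitive_root eps.

Let k_gt0 : (0 < k)%N. Proof. exact: prim_order_gt0 epsP. Qed.
Let epsk : eps ^+ k = 1. Proof. exact: prim_expr_order. Qed.

Let epsXk i : (eps ^+ i) ^+ k = 1.
Proof. by rewrite -exprM mulnC exprM epsk expr1n. Qed.

Lemma prim_root_neq0 i : eps ^+ i != 0.
Proof. by rewrite expf_neq0 // (prim_root_eq0 epsP) -lt0n. Qed.

Lemma prim_root_neq1 i : (0 < i < k)%N -> eps ^+ i != 1.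
Proof.
move=> /andP[i0 ik]; rewrite -(prim_order_dvd epsP).
by apply: contraL ik => /dvdn_leq; rewrite -leqNgt; apply.
Qed.

Lemma sum_prim_root_shift (V : nmodType) (h : K -> V) m :
  \sum_(0 <= i < k) h (eps ^+ i * eps ^+ m) = \sum_(0 <= i < k) h (eps ^+ i).
Proof.
rewrite -(sum_shift (f := fun i => h (eps ^+ i)) m) => [|i].
  by apply: eq_bigr => i _; rewrite exprD.
by rewrite exprD epsk mulr1.
Qed.

Lemma sum_prim_root_expr m : (0 < m < k)%N ->
  \sum_(0 <= i < k) (eps ^+ i) ^+ m = 0.
Proof.
(* The factor [eps ^+ m - 1] is nonzero and turns the geometric sum into eps^(mk) - 1 = 0. *)
move=> mk; apply: (mulfI (x := eps ^+ m - 1)).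
  by rewrite subr_eq0 prim_root_neq1.
rewrite mulr0 big_mkord.
have -> : \sum_(i < k) (eps ^+ i) ^+ m = \sum_(i < k) (eps ^+ m) ^+ i.
  by apply: eq_bigr => i _; rewrite -!exprM mulnC.
by rewrite -subrX1 -exprM mulnC exprM epsk expr1n subrr.
Qed.

Lemma prim_root_sub_neq0 w i : w ^+ k != 1 -> w - eps ^+ i != 0.
Proof.
by apply: contraNneq => /eqP; rewrite subr_eq0 => /eqP ->; rewrite epsXk.
Qed.

Lemma prim_root_mul_sub1_neq0 w i : w ^+ k != 1 -> eps ^+ i * w - 1 != 0.
Proof.
apply: contraNneq => /eqP; rewrite subr_eq0 => /eqP E.
by rewrite -(mul1r (w ^+ k)) -{1}(epsXk i) -exprMn E expr1n.
Qed.

(** Dividing w^k - 1 = w^k - eps^(ik) by w - eps^i gives a homogeneous sum in w and eps^i; summed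
    over i, only its term m = 0 survives. *)
Lemma sum_inv_sub_prim_root w : w ^+ k != 1 ->
  \sum_(0 <= i < k) (w - eps ^+ i)^-1 = k%:R * w ^+ k.-1 / (w ^+ k - 1).
Proof.
move=> wk; have wk0 : w ^+ k - 1 != 0 by rewrite subr_eq0.
apply: (mulIf wk0); rewrite divfK // mulr_suml.
transitivity (\sum_(0 <= i < k) \sum_(m < k) w ^+ (k.-1 - m) * (eps ^+ i) ^+ m).
  apply: eq_bigr => i _; apply: (mulfI (prim_root_sub_neq0 i wk)).
  by rewrite mulVKf ?prim_root_sub_neq0 // -subrXX epsXk.
rewrite exchange_big /=; move: sum_prim_root_expr.
move: k_gt0; case: (k) => // k' _ orth; rewrite big_ord_recl [X in _ + X]big1 => [|m _].
  by rewrite /= addr0 -mulr_sumr subn0 sumr_const_nat subn0 mulrC.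
by rewrite -mulr_sumr orth ?mulr0 // ltn_ord andbT.
Qed.

Lemma sum_inv_prim_root_sub1 w : w ^+ k != 1 ->
  \sum_(0 <= i < k) (eps ^+ i * w - 1)^-1 = k%:R / (w ^+ k - 1).
Proof.
move=> wk; have wk0 : w ^+ k - 1 != 0 by rewrite subr_eq0.
apply: (mulIf wk0); rewrite divfK // mulr_suml.
transitivity (\sum_(0 <= i < k) \sum_(m < k) w ^+ m * (eps ^+ i) ^+ m).
  apply: eq_bigr => i _; apply: (mulfI (prim_root_mul_sub1_neq0 i wk)).
  rewrite mulVKf ?prim_root_mul_sub1_neq0 // -[in LHS](mul1r (w ^+ k)) -{1}(epsXk i) -exprMn.
  by rewrite subrX1; congr (_ * _); apply: eq_bigr => m _; rewrite exprMn mulrC.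
rewrite exchange_big /=; move: sum_prim_root_expr.
move: k_gt0; case: (k) => // k' _ orth; rewrite big_ord_recl [X in _ + X]big1 => [|m _].
  by rewrite /= addr0 -mulr_sumr mul1r sumr_const_nat subn0.
by rewrite -mulr_sumr orth ?mulr0 // ltn_ord andbT.
Qed.

(** The summands at i and k - i add up to 1, so the indices 0 < i < k contribute (k - 1)/2; the
    summand at i = 0 vanishes because [0^-1 = 0]. *)
Lemma sum_prim_root_sub1 :
  \sum_(0 <= i < k) eps ^+ i * (eps ^+ i - 1)^-1 = (k%:R - 1) / 2.
Proof.
pose h i := eps ^+ i * (eps ^+ i - 1)^-1.
have hN i : (0 < i < k)%N -> h i + h (k - i)%N = 1.
  move=> ik; have e1 := prim_root_neq1 ik; have e0 := prim_root_neq0 i.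
  have -> : h (k - i)%N = (1 - eps ^+ i)^-1.
    rewrite /h; have -> : eps ^+ (k - i) = (eps ^+ i)^-1.
      apply: (mulIf e0); rewrite mulVf // -exprD subnK ?epsk //.
      by case/andP: ik => _ /ltnW.
    rewrite -invfM; congr (_^-1).
    by rewrite mulrBr divff // mulr1.
  by rewrite /h -[1 - _]opprB invrN -[X in _ - X]mul1r -mulrBl divff ?subr_eq0.
rewrite big_ltn // expr0 subrr invr0 mulr0 add0r.
have two0 : (2 : K) != 0 by rewrite pnatr_eq0.
apply: (mulIf two0); rewrite divfK // mulr_natr mulr2n.
rewrite [X in _ + X]big_nat_rev -big_split /=.
rewrite (eq_big_nat _ _ (F2 := fun=> 1)) => [|i ik].
  by rewrite sumr_const_nat natrB.
by rewrite add1n subSS hN.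
Qed.

Lemma sum_prim_root_delta (V : nmodType) (x : V) a :
  \sum_(0 <= i < k) (if eps ^+ i == eps ^+ a then x else 0) = x.
Proof.
rewrite -(sum_prim_root_shift (fun z => if z == eps ^+ a then x else 0) a).
rewrite big_ltn // expr0 mul1r eqxx big1_seq ?addr0 // => i.
rewrite mem_index_iota => ik; rewrite ifN //.
rewrite -[X in _ != X]mul1r; apply: contraNneq (prim_root_neq1 ik) => /mulIf ->//.
exact: prim_root_neq0.
Qed.

Lemma sum_prim_root_partial_fractions w a : w ^+ k != 1 ->
  \sum_(0 <= i < k) (eps ^+ i * w - 1)^-1 * (eps ^+ a / eps ^+ i - 1)^-1 =
  (eps ^+ a * w - 1)^-1 *
    (k%:R / (w ^+ k - 1) + (k%:R - 1) / 2 - (eps ^+ a * w - 1)^-1).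
Proof.
move=> wk; set u := eps ^+ a; set v := (u * w - 1)^-1.
have u0 : u != 0 by exact: prim_root_neq0.
have uw : u * w - 1 != 0 by exact: prim_root_mul_sub1_neq0.
(* With z = eps^i the summand is z / ((z w - 1)(u - z)), and [t] is its partial fraction form. At z
   = u the summand is 0 by [0^-1 = 0], while the first part of [t] gives v (1 + v); hence the
   correction. *)
pose t z := v * (1 + (z * w - 1)^-1 + z * (u - z)^-1)
            + (if z == u then - (v * (1 + v)) else 0).
rewrite (eq_bigr (fun i => t (eps ^+ i))) => [|i _]; last first.
  have ew := prim_root_mul_sub1_neq0 i wk.
  move: (eps ^+ i) (prim_root_neq0 i) ew => e e0 ew.
  rewrite /t; have [->|eu] := eqVneq e u.
    by rewrite divff // !subrr invr0 !mulr0 addr0 subrr.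
  rewrite /v addr0; field.
  by rewrite uw e0 ew subr_eq0 eq_sym eu.
rewrite /t big_split /= sum_prim_root_delta -mulr_sumr !big_split /=.
rewrite sumr_const_nat subn0 sum_inv_prim_root_sub1 //.
have -> : \sum_(0 <= i < k) eps ^+ i * (u - eps ^+ i)^-1 = - ((k%:R - 1) / 2).
  rewrite -(sum_prim_root_shift (fun z => z * (u - z)^-1) a) -/u.
  rewrite -sum_prim_root_sub1 -sumrN; apply: eq_bigr => i _.
  rewrite -{2}[u]mul1r -mulrBl invfM mulrACA divff // mulr1 -mulrN -invrN.
  by rewrite opprB.
by field; rewrite subr_eq0.
Qed.

(** For eps^a different from 1 the sum telescopes. The value at eps^a = 1 then equals the sum over
    all a, in which the two factors separate. *)
Lemma sum_prim_root_convolution (w : K) a : w != 0 -> w ^+ k != 1 ->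
  \sum_(0 <= i < k) (eps ^+ i * w - 1)^-1 * (w - eps ^+ a / eps ^+ i)^-1 =
  if eps ^+ a == 1 then k%:R ^+ 2 * w ^+ k.-1 / (w ^+ k - 1) ^+ 2 else 0.
Proof.
move=> w0 wk.
have offdiag b : eps ^+ b != 1 ->
    \sum_(0 <= i < k) (eps ^+ i * w - 1)^-1 * (w - eps ^+ b / eps ^+ i)^-1 = 0.
  set u := eps ^+ b => u1; pose g z := z / (z * w - 1).
  have u0 : u != 0 by exact: prim_root_neq0.
  (* At z = eps^i the summand is (g(z) - g(z/u)) / (1 - u). The root 1/u is written as
     [eps ^+ (b * k.-1)] so that the shift lemma applies. *)
  transitivity (\sum_(0 <= i < k)
      ((1 - u)^-1 * (g (eps ^+ i) - g (eps ^+ i * eps ^+ (b * k.-1))))).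
    apply: eq_bigr => i _.
    have ew := prim_root_mul_sub1_neq0 i wk.
    have -> : eps ^+ (b * k.-1) = u^-1.
      apply: (mulIf u0); rewrite mulVf // -exprD -mulnSr prednK //.
      by rewrite mulnC exprM epsk expr1n.
    have := prim_root_mul_sub1_neq0 (i + b * k.-1) wk.
    have -> : eps ^+ (i + b * k.-1) = eps ^+ i / u.
      apply: (mulIf u0); rewrite divfK // -exprD -addnA -mulnSr prednK //.
      by rewrite exprD mulnC exprM epsk expr1n mulr1.
    move: (eps ^+ i) (prim_root_neq0 i) ew => e e0 ew euw.
    have euw' : e * w - u != 0.
      apply: contraNneq euw => /(congr1 (fun x => x / u)).
      by rewrite mulrBl divff // mul0r mulrAC => ->.
    rewrite /g; field.
    by rewrite mulN1r ew u0 e0 euw' subr_eq0 eq_sym u1.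
  by rewrite -mulr_sumr sumrB (sum_prim_root_shift g) subrr mulr0.
case: ifPn => [/eqP a1|]; last exact: offdiag.
transitivity (\sum_(0 <= j < k) \sum_(0 <= i < k)
  (eps ^+ i * w - 1)^-1 * (w - eps ^+ j / eps ^+ i)^-1).
  rewrite [RHS]big_ltn // [X in _ + X]big1_seq => [|j].
    by rewrite addr0; apply: eq_bigr => i _; rewrite a1 expr0.
  by rewrite mem_index_iota => jk; rewrite offdiag // prim_root_neq1.
rewrite exchange_big /=.
transitivity (\sum_(0 <= i < k) (eps ^+ i * w - 1)^-1 *
    (k%:R * w ^+ k.-1 / (w ^+ k - 1))).
  apply: eq_bigr => i _; rewrite -mulr_sumr -(sum_inv_sub_prim_root wk).
  congr (_ * _).
  rewrite -(sum_prim_root_shift (fun z => (w - z / eps ^+ i)^-1) i).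
  by apply: eq_bigr => j _; rewrite mulfK // prim_root_neq0.
rewrite -mulr_suml sum_inv_prim_root_sub1 //; field.
by rewrite subr_eq0.
Qed.
End RootsOfUnity.

(** * Twisted sums in an algebra *)

Section TwistedSums.
Variables (K : numFieldType) (E : unitAlgType K) (k : nat) (eps : K) (A T : E).

Definition twistor := (eps *: T - 1) * (T - 1)^-1 * A.

(** S_lambda with [w] for mu(lambda); [A^-1 ^+ i] stands for A^(k-i), which makes the summands
    periodic in i when A^k = 1 and B^k = 1. *)
Definition twist_sum (l w : K) (x : E) :=
  \sum_(0 <= i < k) (l / (eps ^+ i * w - 1)) *:
    ((w *: T - 1) * (T - 1)^-1 * A^-1 ^+ i * x * twistor ^+ i).

(* The term i = 0 vanishes, since 0^-1 = 0. *)
Definition twist_sum_deriv (x : E) :=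
  \sum_(0 <= i < k) (eps ^+ i - 1)^-1 *: (A^-1 ^+ i * x * twistor ^+ i)
  + T * (T - 1)^-1 * x.

Definition twist_sum_inv (l w : K) (x : E) := \sum_(0 <= j < k)
  ((w ^+ k - 1) ^+ 2 / (l * k%:R ^+ 2 * w ^+ (k - 1) * (w - eps ^+ j))) *:
  ((eps ^+ (k - j) *: T - 1) * ((eps ^+ (k - j) * w) *: T - 1)^-1 * A ^+ (k - j)
   * x * twistor ^+ j).

End TwistedSums.

(** * Commutation rules for A, T and the powers of B *)

Section TwistedAlgebra.
Variables (K : numFieldType) (E : unitAlgType K) (k : nat) (eps : K) (A T : E).
Hypothesis epsP : k.-primitive_root eps.
Hypothesis Ak : A ^+ k = 1.
Hypothesis AT : A * T = eps *: (T * A).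
Hypothesis T1 : T - 1 \is a GRing.unit.

Let k_gt0 : (0 < k)%N. Proof. exact: prim_order_gt0 epsP. Qed.
Let epsk : eps ^+ k = 1. Proof. exact: prim_expr_order. Qed.

Let D : E := (T - 1)^-1.
Let B : E := twistor eps A T.
(** Equal to (c T - 1)(T - 1)^-1, but written as a combination of 1 and [D] so that coefficients can
    be compared. *)
Let G (c : K) : E := c%:A + (c - 1) *: D.

Let A_unit : A \is a GRing.unit.
Proof. by apply/unitrP; exists (A ^+ k.-1); rewrite -exprS -exprSr prednK. Qed.

Lemma twist_expr (m : K) i :
  A ^+ i * (m *: T - 1) = ((eps ^+ i * m) *: T - 1) * A ^+ i.
Proof.
rewrite mulrBr mulrBl mulr1 mul1r -scalerAr -scalerAl; congr (_ - _).
rewrite [_ * m]mulrC -scalerA; congr (_ *: _).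
elim: i => [|i IHi]; first by rewrite !expr0 mul1r mulr1 scale1r.
rewrite exprSr -mulrA AT -scalerAr mulrA IHi -scalerAl scalerA -exprS.
by rewrite -mulrA -exprSr.
Qed.

Lemma expr_subn_inv i : (i <= k)%N -> A ^+ (k - i) = A^-1 ^+ i.
Proof. by move=> ik; rewrite exprVn -[RHS]mul1r -Ak -{2}(subnK ik) exprD mulrK ?unitrX. Qed.

Let scaleT_D c : (c *: T - 1) * D = G c.
Proof.
have -> : c *: T - 1 = c *: (T - 1) + (c - 1)%:A.
  by rewrite scalerBr scalerBl scale1r addrA subrK.
by rewrite mulrDl -!scalerAl mulrV // mul1r.
Qed.

Let D_scaleT c : D * (c *: T - 1) = G c.
Proof.
have -> : c *: T - 1 = c *: (T - 1) + (c - 1)%:A.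
  by rewrite scalerBr scalerBl scale1r addrA subrK.
by rewrite mulrDr -!scalerAr mulVr // mulr1.
Qed.

(** In [D * (eps ^+ i *: T - 1) * A ^+ i] the last two factors equal A^i (T - 1), and T - 1 cancels
    the [D] at the left of [G m]. *)
Let GA_mulG i m : G (eps ^+ i) * A ^+ i * G m = G (eps ^+ i * m) * A ^+ i.
Proof.
rewrite -(D_scaleT (eps ^+ i)) -(mulrA D) -{1}[eps ^+ i]mulr1 -twist_expr.
by rewrite scale1r -D_scaleT !mulrA (mulrK T1) -mulrA twist_expr mulrA D_scaleT.
Qed.

Let BE i : B ^+ i = G (eps ^+ i) * A ^+ i.
Proof.
elim: i => [|i IHi].
  by rewrite !expr0 mulr1 /G subrr scale0r addr0 scale1r.
by rewrite exprSr IHi /B /twistor scaleT_D mulrA GA_mulG -mulrA -!exprSr.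
Qed.

Let Bk : B ^+ k = 1.
Proof. by rewrite BE epsk Ak mulr1 /G subrr scale0r addr0 scale1r. Qed.

(** * Multiplicativity of the twisted sum *)

Section Multiplicativity.
Variables (l w : K).
Hypothesis l0 : l != 0.
Hypothesis wk : w ^+ k != 1.
Hypothesis lw : l^-1 = k%:R / (w ^+ k - 1) + (k%:R - 1) / 2.

Let M : E := (w *: T - 1) * D.
Let p i := l / (eps ^+ i * w - 1).
(** The coefficient of R at the index difference a - b; [c a a] is 0 by [0^-1 = 0]. *)
Let c a b := (eps ^+ a / eps ^+ b - 1)^-1.

Local Notation S := (twist_sum k eps A T l w).
Local Notation R := (twist_sum_deriv k eps A T).

Let SE x : S x = \sum_(0 <= i < k) p i *: (M * A^-1 ^+ i * x * B ^+ i).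
Proof. by []. Qed.

Let RE x :
  R x = \sum_(0 <= i < k) (eps ^+ i - 1)^-1 *: (A^-1 ^+ i * x * B ^+ i) + T * D * x.
Proof. by []. Qed.

Let TD : T * D = 1 + D.
Proof. by rewrite -{1}[T](subrK 1) mulrDl mul1r mulrV ?T1. Qed.

Let epsDk i : eps ^+ (i + k) = eps ^+ i. Proof. by rewrite exprD epsk mulr1. Qed.
Let ADk i : A ^+ (i + k) = A ^+ i. Proof. by rewrite exprD Ak mulr1. Qed.
Let AVDk i : A^-1 ^+ (i + k) = A^-1 ^+ i.
Proof. by rewrite !exprVn ADk. Qed.
Let BDk i : B ^+ (i + k) = B ^+ i. Proof. by rewrite exprD Bk mulr1. Qed.

Let eps0 i : eps ^+ i != 0. Proof. exact: (prim_root_neq0 epsP). Qed.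

Let A_AV i : A ^+ i * A^-1 ^+ i = 1. Proof. by rewrite exprVn mulrV ?unitrX. Qed.

Section Bilinear.
Variables X Y : E.
Let F1 a b : E := M * A^-1 ^+ a * X * A ^+ a * A^-1 ^+ b * Y * B ^+ b.
Let FD a b : E := M * A^-1 ^+ a * X * D * A ^+ a * A^-1 ^+ b * Y * B ^+ b.

Let FG z a b :
  M * A^-1 ^+ a * X * (G z * A ^+ a) * A^-1 ^+ b * Y * B ^+ b =
  z *: F1 a b + (z - 1) *: FD a b.
Proof.
rewrite /G mulrDl mulrDr -!scalerAl mul1r -!scalerAr !mulrDl -!scalerAl.
by rewrite /F1 /FD !mulrA.
Qed.

Let F1_diag a : F1 a a = M * A^-1 ^+ a * (X * Y) * B ^+ a.
Proof. by rewrite /F1 -(mulrA (_ * X)) A_AV mulr1 !mulrA. Qed.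

Let FD_diag a : FD a a = M * A^-1 ^+ a * (X * D * Y) * B ^+ a.
Proof. by rewrite /FD -(mulrA (_ * X * D)) A_AV mulr1 !mulrA. Qed.

Let SS : S X * S Y = \sum_(0 <= a < k) \sum_(0 <= b < k)
  (p a * p b) *: ((w * eps ^+ a) *: F1 a b + (w * eps ^+ a - 1) *: FD a b).
Proof.
rewrite !SE mulr_suml; apply: eq_bigr => a _.
rewrite mulr_sumr; apply: eq_bigr => b _.
rewrite -scalerAl -scalerAr scalerA; congr (_ *: _).
(* Where the two factors meet, B^a M = G(eps^a) A^a G(w) = G(w eps^a) A^a. *)
rewrite -FG [w * _]mulrC -GA_mulG -BE /M scaleT_D.
by rewrite !mulrA.
Qed.

(** The index of R is shifted by that of S, so that [a] is the total exponent of A^-1 left of X. The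
    part coming from C stays a value of S, to cancel against the same term in [S_RXY]. *)
Let S_RX_Y : S (R X * Y) =
  \sum_(0 <= a < k) \sum_(0 <= b < k) (p b * c a b) *:
    ((eps ^+ a / eps ^+ b) *: F1 a b + (eps ^+ a / eps ^+ b - 1) *: FD a b)
  + S (T * D * (X * Y)).
Proof.
rewrite !SE RE exchange_big /= -big_split /=; apply: eq_bigr => b _.
rewrite mulrDl mulrDr mulrDl scalerDr; congr (_ + _); last by rewrite !mulrA.
rewrite mulr_suml mulr_sumr mulr_suml scaler_sumr.
rewrite -[RHS](sum_shift b) => [|i].
  apply: eq_bigr => i _; rewrite -FG -scalerAl -scalerAr -scalerAl scalerA.
  have -> : eps ^+ (i + b) / eps ^+ b = eps ^+ i by rewrite exprD mulfK.
  rewrite /c exprD mulfK //; congr (_ *: _).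
  rewrite BE [X in _ = _ * (_ * X) * _ * _ * _]exprD [in RHS]addnC exprD.
  by rewrite !mulrA -[in RHS](mulrA _ (A ^+ b)) A_AV mulr1.
by rewrite /c /F1 /FD epsDk AVDk ADk.
Qed.

Let S_X_RY : S (X * R Y) =
  \sum_(0 <= a < k) \sum_(0 <= b < k) (p a * c b a) *: F1 a b
  + \sum_(0 <= a < k) p a *: (F1 a a + FD a a).
Proof.
rewrite SE RE -big_split /=; apply: eq_bigr => a _.
rewrite mulrDr mulrDr mulrDl scalerDr; congr (_ + _); last first.
  by rewrite TD mulrDl mul1r F1_diag FD_diag -mulrDl -mulrDr -(mulrA X) -mulrDr.
rewrite !mulr_sumr mulr_suml scaler_sumr.
rewrite -[RHS](sum_shift a) => [|i].
  apply: eq_bigr => i _; rewrite -!scalerAr -scalerAl scalerA.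
  rewrite /c exprD mulfK //; congr (_ *: _).
  rewrite /F1 [in A^-1 ^+ (i + a)]addnC [A^-1 ^+ (a + i)]exprD [B ^+ (i + a)]exprD.
  by rewrite !mulrA -(mulrA _ (A ^+ a)) A_AV mulr1.
by rewrite /c /F1 epsDk AVDk BDk.
Qed.

Let S_RXY : S (R (X * Y)) =
  \sum_(0 <= a < k) \sum_(0 <= b < k) (p b * c a b) *: F1 a a
  + S (T * D * (X * Y)).
Proof.
rewrite !SE RE exchange_big /= -big_split /=; apply: eq_bigr => b _.
rewrite mulrDr mulrDl scalerDr; congr (_ + _).
rewrite mulr_sumr mulr_suml scaler_sumr.
rewrite -[RHS](sum_shift b) => [|i].
  apply: eq_bigr => i _; rewrite -scalerAr -scalerAl scalerA.
  rewrite /c exprD mulfK //; congr (_ *: _).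
  by rewrite F1_diag addnC exprD addnC exprD !mulrA.
by rewrite /c !F1_diag epsDk AVDk BDk.
Qed.

(** For a and b distinct the coefficients agree as rational functions of the roots. On the diagonal
    the sum over b coming from R(XY) has to be evaluated, and there the relation [lw] enters. *)
Lemma twist_sum_mul :
  S X * S Y = S (X * Y + l *: (R X * Y + X * R Y - R (X * Y))).
Proof.
have SD x y : S (x + y) = S x + S y.
  rewrite !SE -big_split /=; apply: eq_bigr => i _.
  by rewrite mulrDr mulrDl scalerDr.
have SZ z x : S (z *: x) = z *: S x.
  rewrite !SE scaler_sumr; apply: eq_bigr => i _.
  by rewrite -scalerAr -scalerAl !scalerA mulrC.
have SN x : S (- x) = - S x by rewrite -scaleN1r SZ scaleN1r.
rewrite !SD SZ !SD SN SS S_RX_Y S_X_RY S_RXY.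
have -> : S (X * Y) = \sum_(0 <= a < k) p a *: F1 a a.
  by rewrite SE; apply: eq_bigr => a _; rewrite F1_diag.
set s1 := (X in X + S _ + _); set s2 := (X in _ + (X + _) - _).
set s3 := (X in _ - (X + _)); set s4 := (X in _ + (_ + X) - _).
have -> : s1 + S (T * D * (X * Y)) + (s2 + s4) - (s3 + S (T * D * (X * Y))) =
    s1 + s2 + (s4 - s3).
  by rewrite addrACA opprD -[LHS]addrA; congr (_ + _); rewrite [S _ + s4]addrC addrACA subrr addr0.
rewrite scalerDr [RHS]addrCA /s1 /s2 -big_split /= scaler_sumr.
rewrite /s3 /s4 -sumrB scaler_sumr -!big_split /=.
apply: eq_big_nat => a ak.
have uw := prim_root_mul_sub1_neq0 epsP a wk.
(* By partial fractions and [lw] the sum over b is p a (1/l - 1/(eps^a w - 1)). *)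
have diag : l * \sum_(0 <= b < k) p b * c a b = p a + l * p a - p a * p a * (w * eps ^+ a).
  under eq_bigr do rewrite /p /c -mulrA.
  rewrite -mulr_sumr (sum_prim_root_partial_fractions epsP) // -lw /p.
  by field; rewrite l0 uw.
set x := (X in _ = _ + X).
have xE : x = (p a * p a * (w * eps ^+ a)) *: F1 a a + (l * p a) *: FD a a.
  rewrite /x -scaler_suml scalerBr !scalerDr !scalerA addrAC !addrA -scalerDl.
  by rewrite -scalerBl diag; congr (_ *: _ + _); ring.
(* The remaining diagonal term is placed in the sum over b at b = a, so that both sides are compared
   for each pair of indices. *)
rewrite -(sum_prim_root_delta epsP x a) -big_split /= scaler_sumr -big_split /=.
rewrite xE; apply: eq_big_nat => b bk; have vw := prim_root_mul_sub1_neq0 epsP b wk.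
case: ifPn => [|ab].
  rewrite (eq_prim_root_expr epsP) !modn_small ?(andP ak).2 ?(andP bk).2 // => /eqP ->.
  rewrite /c divff // subrr invr0 !mulr0 !scale0r addr0 scaler0 add0r.
  rewrite scalerDr !scalerA; congr (_ + _ *: _).
  by rewrite /p; field; rewrite uw.
rewrite addr0 !scalerDr !scalerA addrAC -scalerDl /c /p.
have uv : eps ^+ b - eps ^+ a != 0 by rewrite subr_eq0.
have vu : eps ^+ a - eps ^+ b != 0 by rewrite subr_eq0 eq_sym.
by congr (_ *: _ + _ *: _); field; rewrite !mulN1r ?eps0 ?uw ?vw ?uv ?vu.
Qed.
End Bilinear.

(** * The inverse of the twisted sum *)

Hypothesis w0 : w != 0.
Hypothesis wT : w *: T - 1 \is a GRing.unit.

Let q i := (w ^+ k - 1) ^+ 2 / (l * k%:R ^+ 2 * w ^+ (k - 1) * (w - eps ^+ i)).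
Let N : E := (T - 1) * (w *: T - 1)^-1.

Local Notation V := (twist_sum_inv k eps A T l w).

(** Moving A^(k-j) to the left by [twist_expr] turns the matrix factor of Q_j into A^-j N, so that
    the same N = M^-1 occurs in every summand. *)
Let twist_sum_invE x :
  V x = \sum_(0 <= j < k) q j *: (A^-1 ^+ j * (N * x) * B ^+ j).
Proof.
apply: eq_big_nat => j /andP[_ /ltnW jk]; congr (_ *: (_ * _)).
rewrite mulrA; congr (_ * _); rewrite -expr_subn_inv //.
have wT' : (eps ^+ (k - j) * w) *: T - 1 \is a GRing.unit.
  by rewrite -(unitrMl _ (unitrX (k - j) A_unit)) -twist_expr unitrMr ?unitrX.
rewrite /N mulrA -[X in _ * (X - 1)]scale1r twist_expr mulr1 -!mulrA; congr (_ * _).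
by apply: (mulrI wT'); rewrite mulVKr // mulrA -twist_expr mulrK.
Qed.

(** Both compositions of S and V have this shape. Collecting a = i + j leaves the cyclic convolution
    of [p] and [q] as the coefficient of [h a]; it is 1 at a = 0 and 0 at the other indices below
    k. *)
Let convolution (W : lmodType K) (h : nat -> W) : (forall i, h (i + k)%N = h i) ->
  \sum_(0 <= i < k) \sum_(0 <= j < k) (p i * q j) *: h (i + j)%N = h 0%N.
Proof.
move=> hk; pose r a i := p i * ((w ^+ k - 1) ^+ 2 /
  (l * k%:R ^+ 2 * w ^+ (k - 1) * (w - eps ^+ a / eps ^+ i))).
transitivity (\sum_(0 <= i < k) \sum_(0 <= a < k) r a i *: h a).
  apply: eq_bigr => i _; rewrite -[RHS](sum_shift i) => [|a].
    by apply: eq_bigr => j _; rewrite /r exprD mulfK // addnC.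
  by rewrite hk /r epsDk.
have wk0 : w ^+ k - 1 != 0 by rewrite subr_eq0.
have wX0 : w ^+ k.-1 != 0 by rewrite expf_neq0.
have kR0 : (k%:R : K) != 0 by rewrite pnatr_eq0 -lt0n.
have rE a : \sum_(0 <= i < k) r a i = if eps ^+ a == 1 then 1 else 0.
  transitivity ((w ^+ k - 1) ^+ 2 / (k%:R ^+ 2 * w ^+ (k - 1)) *
    \sum_(0 <= i < k) (eps ^+ i * w - 1)^-1 * (w - eps ^+ a / eps ^+ i)^-1).
    rewrite mulr_sumr; apply: eq_bigr => i _.
    rewrite /r /p !invfM.
    by rewrite -[RHS]mul1r -(divff l0); ring.
  rewrite (sum_prim_root_convolution epsP) // subn1.
  case: ifP => _; last by rewrite mulr0.
  by field; rewrite wk0 wX0 kR0.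
rewrite exchange_big /= (eq_bigr (fun a => (\sum_(0 <= i < k) r a i) *: h a)).
  rewrite big_ltn // rE expr0 eqxx scale1r big1_seq ?addr0 // => a.
  rewrite mem_index_iota => ak.
  by rewrite rE (negPf (prim_root_neq1 epsP ak)) scale0r.
by move=> a _; rewrite scaler_suml.
Qed.

Let MN : M * N = 1.
Proof. by rewrite /M /N mulrA (mulrVK T1) mulrV. Qed.

Let NM : N * M = 1.
Proof. by rewrite /M /N mulrA (mulrVK wT) mulrV. Qed.

(** The N of the outer sum meets the M of the inner one, so they cancel before the convolution is
    evaluated. *)
Lemma twist_sumK : cancel S V.
Proof.
move=> x; rewrite twist_sum_invE.
transitivity (\sum_(0 <= i < k) \sum_(0 <= j < k) (p i * q j) *:
  (A^-1 ^+ (i + j) * x * B ^+ (i + j))).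
  rewrite exchange_big /=; apply: eq_bigr => j _.
  rewrite !SE !mulr_sumr mulr_suml scaler_sumr.
  apply: eq_bigr => i _; rewrite -[N * _]scalerAr -[_ * (_ *: _)]scalerAr.
  rewrite -[_ * B ^+ j]scalerAl scalerA mulrC.
  congr (_ *: _); rewrite -!(mulrA M) (mulrA N M) NM mul1r.
  by rewrite [B ^+ (i + j)]exprD addnC exprD !mulrA.
rewrite (convolution (h := fun i => A^-1 ^+ i * x * B ^+ i)) => [|i].
  by rewrite !expr0 mul1r mulr1.
by rewrite AVDk BDk.
Qed.

(** In this order M and N stand apart; they are joined only after the convolution has left the index
    0. *)
Lemma twist_sum_invK : cancel V S.
Proof.
move=> x; transitivity (\sum_(0 <= i < k) \sum_(0 <= j < k) (p i * q j) *:
  (M * (A^-1 ^+ (i + j) * (N * x) * B ^+ (i + j)))).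
  rewrite SE; apply: eq_bigr => i _; rewrite twist_sum_invE mulr_sumr mulr_suml scaler_sumr.
  apply: eq_bigr => j _; rewrite -[_ * (_ *: _)]scalerAr -[_ * B ^+ i]scalerAl.
  by rewrite scalerA; congr (_ *: _); rewrite [in RHS]exprD addnC !exprD !mulrA.
rewrite (convolution (h := fun i => M * (A^-1 ^+ i * (N * x) * B ^+ i))) => [|i].
  by rewrite !expr0 mul1r mulr1 mulrA MN mul1r.
by rewrite AVDk BDk.
Qed.

End Multiplicativity.

End TwistedAlgebra.

(** * Limits at 0 *)

(** By de Moivre eps^k = 1, so the order m of eps divides k. If m < k, then y = pi m / k lies
    strictly between 0 and pi and sin y > 0, whereas eps^m = 1 gives cos 2y = 1, that is sin y =
    0. *)
Lemma cexp_primitive_root (R : realType) (k : nat) : (0 < k)%N ->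
  k.-primitive_root (cexp (0 +i* (2 * pi / k%:R)) : Cx R).
Proof.
move=> k0; set x : R := 2 * pi / k%:R.
have k0R : (0 : R) < k%:R by rewrite ltr0n.
have powE m : (cexp (0 +i* x) : R[i]) ^+ m = cos (x *+ m) +i* sin (x *+ m).
  elim: m => [|m IHm]; first by rewrite expr0 mulr0n cos0 sin0.
  rewrite exprS IHm /cexp /= expR0 mul1r; simpc.
  by rewrite mulrS cosD sinD; congr (_ +i* _); ring.
have epsk : (cexp (0 +i* x) : R[i]) ^+ k = 1.
  rewrite powE -mulr_natr divfK ?gt_eqF // mulrC -[2]/(1 *+ 2) mulr_natr.
  by rewrite cos2pi sin2pi.
have [m mP mk] := prim_order_exists k0 epsk.
have [<-//|mk'] := eqVneq m k.
have m0 := prim_order_gt0 mP.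
have ltmk : (m < k)%N by rewrite ltn_neqAle mk' dvdn_leq.
have := prim_expr_order mP; rewrite powE => -[+ _].
pose y : R := pi * m%:R / k%:R.
have -> : x *+ m = y *+ 2.
  by rewrite -[x *+ m]mulr_natr -[y *+ 2]mulr_natr /x /y; ring.
have : 0 < sin y.
  apply: sin_gt0_pi; rewrite divr_gt0 ?mulr_gt0 ?pi_gt0 ?ltr0n //=.
  by rewrite ltr_pdivrMr // ltr_pM2l ?pi_gt0 // ltr_nat.
move=> sy; rewrite cos_mulr2n cos2sin2 => h.
have : sin y ^+ 2 = 0 by lra.
by move=> /eqP; rewrite sqrf_eq0 gt_eqF.
Qed.

(** * Removable singularities and quadratic bounds *)

Section Continuity.
Variable K : numFieldType.
Implicit Types f g mu : K -> K.

Lemma continuous_horner_comp (p : {poly K}) f x :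
  {for x, continuous f} -> {for x, continuous (fun l => p.[f l])}.
Proof.
move=> fc; elim/poly_ind: p => [|p c IHp].
  have -> : (fun l => 0.[f l]) = cst 0 by apply/funext => l; rewrite horner0.
  exact: cst_continuous.
have -> : (fun l => (p * 'X + c%:P).[f l]) = (fun l => p.[f l]) \* f \+ cst c.
  by apply/funext => l; rewrite !hornerE.
apply: continuousD; last exact: cst_continuous.
exact: continuousM.
Qed.

Lemma continuous_near_neq f x y :
  {for x, continuous f} -> f x != y -> \forall l \near x, f l != y.
Proof.
move=> /(@cvgrPdist_lt _ _ _ (nbhs x)) fc fxy.
have : 0 < `|f x - y| by rewrite normr_gt0 subr_eq0.
by move=> /fc; apply: filterS => l; apply: contraTneq => ->; rewrite ltxx.
Qed.

Lemma remove_sing0 f g :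
  (\forall l \near (0 : K)^', f l = g l) -> {for 0, continuous g} ->
  remove_sing f 0 = g 0.
Proof.
move=> fg gc; rewrite /remove_sing eqxx; apply: cvg_lim.
  exact: norm_hausdorff.
apply: cvg_trans; first by apply: near_eq_cvg; apply: filterS fg => l ->.
exact/continuous_withinNx.
Qed.

(** A form of O(l^2) that passes easily through sums and scalar multiples; it is converted to [=O_]
    by [near_sqr_bounded_eqO]. *)
Definition near_sqr_bounded (V : normedModType K) (F : K -> V) :=
  exists C : K, \forall l \near (0 : K), `|F l| <= C * `|l ^+ 2|.

Lemma near_sqr_bounded_mul f g :
  (\forall l \near (0 : K), f l = l ^+ 2 * g l) -> {for 0, continuous g} ->
  near_sqr_bounded f.
Proof.
move=> fg /(@cvgrPdist_lt _ _ _ (nbhs 0)) /(_ _ ltr01) gc.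
exists (`|g 0| + 1); apply: filterS2 fg gc => l -> gl.
rewrite normrM mulrC ler_wpM2r //.
rewrite -[g l](subrK (g 0)) addrC (le_trans (ler_normD _ _)) // lerD2l.
by rewrite distrC ltW.
Qed.

Lemma near_sqr_boundedD (V : normedModType K) (F1 F2 : K -> V) :
  near_sqr_bounded F1 -> near_sqr_bounded F2 ->
  near_sqr_bounded (fun l => F1 l + F2 l).
Proof.
move=> [C1 h1] [C2 h2]; exists (C1 + C2); apply: filterS2 h1 h2 => l h1 h2.
by rewrite mulrDl (le_trans (ler_normD _ _)) // lerD.
Qed.

Lemma near_sqr_boundedZ (V : normedModType K) f (v : V) :
  near_sqr_bounded f -> near_sqr_bounded (fun l => f l *: v).
Proof.
move=> [C h]; exists (C * `|v|); apply: filterS h => l h.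
by rewrite normrZ mulrAC ler_wpM2r.
Qed.

Lemma near_sqr_bounded_sum (V : normedModType K) (I : eqType) (r : seq I)
    (F : I -> K -> V) :
  (forall i, i \in r -> near_sqr_bounded (F i)) ->
  near_sqr_bounded (fun l => \sum_(i <- r) F i l).
Proof.
elim: r => [|i r IHr] h.
  by exists 0; apply: filterE => l; rewrite big_nil normr0 mul0r.
have -> : (fun l => \sum_(j <- i :: r) F j l) =
    (fun l => F i l + \sum_(j <- r) F j l).
  by apply/funext => l; rewrite big_cons.
apply: near_sqr_boundedD; first by apply: h; rewrite mem_head.
by apply: IHr => j jr; apply: h; rewrite in_cons jr orbT.
Qed.

Lemma near_sqr_bounded_eqO (V : normedModType K) (F : K -> V) :
  near_sqr_bounded F -> F =O_ (0 : K) (fun l : K => l ^+ 2 : K).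
Proof.
(* A positive constant is required, while [C] is not known to be real; C |l^2| is real because it
   dominates a norm. *)
move=> [C h]; apply/eqO_exP; exists (`|C| + 1).
  by rewrite ltr_wpDl.
apply: filterS h => l /= h; rewrite (le_trans _ (_ : `|C * `|l ^+ 2| | <= _)) //.
  by rewrite (le_trans h) // real_ler_norm // ger0_real // (le_trans _ h).
by rewrite normrM normr_id ler_wpM2r // lerDl.
Qed.

End Continuity.

(** * Scalar coefficients along the branch *)

Section Branch.
Variables (K : numFieldType) (k : nat) (eps : K) (mu : K -> K).
Hypothesis epsP : k.-primitive_root eps.
Hypothesis hmu : root_branch k mu.

Let k_gt0 : (0 < k)%N. Proof. exact: prim_order_gt0 epsP. Qed.
Let kR0 : (k%:R : K) != 0. Proof. by rewrite pnatr_eq0 -lt0n. Qed.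
Let mu0 : mu 0 = 1. Proof. by case: hmu. Qed.
Let muc : {for 0, continuous mu}. Proof. by case: hmu. Qed.

Let s : {poly K} := \sum_(j < k) 'X^j.
Let d : {poly K} := 2%:P - (k%:R - 1)%:P * 'X.

Let sE w : s.[w] = \sum_(j < k) w ^+ j.
Proof. by rewrite horner_sum; apply: eq_bigr => j _; rewrite hornerXn. Qed.
Let dE w : d.[w] = 2 - (k%:R - 1) * w. Proof. by rewrite /d !hornerE. Qed.
Let s1 : s.[1] = k%:R.
Proof. by rewrite sE; under eq_bigr do rewrite expr1n; rewrite sumr_const card_ord. Qed.
Let d0 : d.[0] = 2. Proof. by rewrite dE mulr0 subr0. Qed.

(** The continuous extension of (mu l - 1)/l to l = 0, obtained from (mu - 1) s(mu) = mu^k - 1 = 2 k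
    l / d(l). *)
Let G l := 2 * k%:R / (d.[l] * s.[mu l]).

Let Gc : {for 0, continuous G}.
Proof.
have dsc : {for 0, continuous (fun l => d.[l] * s.[mu l])}.
  apply: (@continuousM _ _ (fun l => d.[l])); last exact: continuous_horner_comp.
  by apply: continuous_horner_comp; exact: (@cvg_id).
apply: (@continuousM _ _ (cst (2 * k%:R))); first exact: cst_continuous.
by apply: continuousV => //; rewrite d0 mu0 s1 mulf_neq0 // pnatr_eq0.
Qed.

Let G0 : G 0 = 1.
Proof. by rewrite /G d0 mu0 s1 divff // mulf_neq0 // pnatr_eq0. Qed.

Let s_neq0 : \forall l \near (0 : K), s.[mu l] != 0.
Proof.
by apply: continuous_near_neq; [exact: continuous_horner_comp | rewrite mu0 s1].
Qed.

Let d_neq0 : \forall l \near (0 : K), d.[l] != 0.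
Proof.
apply: continuous_near_neq; last by rewrite d0 pnatr_eq0.
by apply: continuous_horner_comp; exact: (@cvg_id).
Qed.

Let near_branch_sub1 : \forall l \near (0 : K), mu l - 1 = l * G l.
Proof.
case: hmu => _ _ muk; apply: filterS3 muk s_neq0 d_neq0 => l muk sl dl.
apply: (mulIf sl); rewrite sE -subrX1 muk -sE /G.
move: sl dl; rewrite dE => sl dl; field; by rewrite sl dl.
Qed.

(** These are the scalar hypotheses of the twisted sums; the last two follow from mu^k - 1 = 2 k l /
    d(l). *)
Lemma near_branch : \forall l \near (0 : K), l != 0 ->
  [/\ mu l != 0, mu l ^+ k != 1 &
      l^-1 = k%:R / (mu l ^+ k - 1) + (k%:R - 1) / 2].
Proof.
have mun : \forall l \near (0 : K), mu l != 0.
  by apply: continuous_near_neq => //; rewrite mu0 oner_neq0.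
case: hmu => _ _ muk; apply: filterS3 muk mun d_neq0 => l muk mul dl l0.
have E : mu l ^+ k - 1 = 2 * k%:R * l / d.[l].
  by rewrite muk; move: dl; rewrite dE => dl; field.
have E0 : mu l ^+ k - 1 != 0 by rewrite E !mulf_neq0 ?invr_neq0 ?pnatr_eq0 -?lt0n.
split => //; first by rewrite -subr_eq0.
rewrite E; move: dl; rewrite dE => dl; field.
by rewrite dl kR0 l0.
Qed.

Let near_neq0 (P : set K) : (\forall l \near (0 : K), l != 0 -> P l) ->
  \forall l \near (0 : K)^', P l.
Proof. by apply: filterS => l Pl l0; exact: Pl. Qed.

Local Notation p i l := (remove_sing (fun z => z / (eps ^+ i * mu z - 1)) l).

Let remove_sing_coef0 : \forall l \near (0 : K), p 0%N l = (G l)^-1.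
Proof.
have near_p : \forall l \near (0 : K), l != 0 -> l / (eps ^+ 0 * mu l - 1) = (G l)^-1.
  apply: filterS near_branch_sub1 => l E l0.
  by rewrite expr0 mul1r E invfM mulrA divff // mul1r.
have p0 : p 0%N 0 = (G 0)^-1.
  apply: (remove_sing0 (near_neq0 near_p)).
  by apply: continuousV => //; rewrite G0 oner_neq0.
apply: filterS near_p => l; have [-> // |l0 <- //] := eqVneq l 0.
by rewrite /remove_sing (negPf l0).
Qed.

Let coef_cont i : (0 < i < k)%N ->
  {for 0, continuous (fun l => (eps ^+ i * mu l - 1)^-1)}.
Proof.
move=> ik; apply: continuousV; first by rewrite mu0 mulr1 subr_eq0 (prim_root_neq1 epsP).
have -> : (fun l => eps ^+ i * mu l - 1) = cst (eps ^+ i) \* mu \+ cst (-1) by [].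
apply: continuousD; last exact: cst_continuous.
by apply: continuousM => //; exact: cst_continuous.
Qed.

(** The denominator is eps^i - 1 at l = 0, which is nonzero for these i, so the formula is already
    continuous there. *)
Lemma remove_sing_coef i l : (0 < i < k)%N -> p i l = l / (eps ^+ i * mu l - 1).
Proof.
move=> ik; have [->|l0] := eqVneq l 0; last by rewrite /remove_sing (negPf l0).
rewrite (@remove_sing0 _ _ (fun l => l / (eps ^+ i * mu l - 1))) //.
  by apply: filterE.
by apply: (@continuousM _ _ id); [exact: (@cvg_id) | exact: coef_cont].
Qed.

Lemma remove_sing_coef_at0 i : (i < k)%N -> p i 0 = if i == 0%N then 1 else 0.
Proof.
case: i => [|i] ik; last by rewrite remove_sing_coef // mul0r.
by rewrite (nbhs_singleton remove_sing_coef0) G0 invr1.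
Qed.

Lemma remove_sing_inv_coef_at0 i : (i < k)%N ->
  remove_sing (fun l => (mu l ^+ k - 1) ^+ 2 /
      (l * k%:R ^+ 2 * mu l ^+ (k - 1) * (mu l - eps ^+ i))) 0 =
  if i == 0%N then 1 else 0.
Proof.
(* Since mu^k - 1 = l G s(mu), the coefficient is l h / (mu - eps^i). For i = 0 this is h / G, with
   value 1 at 0; for the other i the factor l remains. *)
move=> ik; pose h l := (G l * s.[mu l]) ^+ 2 / (k%:R ^+ 2 * mu l ^+ (k - 1)).
have hc : {for 0, continuous h}.
  apply: (@continuousM _ _ (fun l => (G l * s.[mu l]) ^+ 2)).
    have GSc : {for 0, continuous (fun l => G l * s.[mu l])}.
      by apply: continuousM => //; exact: continuous_horner_comp.
    exact: (continuousM GSc GSc).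
  apply: continuousV; first by rewrite mu0 expr1n mulr1 expf_neq0.
  have -> : (fun l => k%:R ^+ 2 * mu l ^+ (k - 1)) =
      (fun l => ((k%:R ^+ 2)%:P * 'X^(k - 1)).[mu l]).
    by apply/funext => l; rewrite !hornerE.
  exact: continuous_horner_comp.
have E l : mu l - 1 = l * G l -> mu l ^+ k - 1 = l * (G l * s.[mu l]).
  by move=> E; rewrite sE subrX1 E -(mulrA l).
case: ifPn => [/eqP ->|i0].
  rewrite (@remove_sing0 _ _ (fun l => h l / G l)).
  - by rewrite /h G0 mu0 s1 expr1n mulr1 mul1r divff ?mul1r ?invr1 ?expf_neq0.
  - apply: near_neq0; apply: filterS2 near_branch_sub1 near_branch => l E1 + l0.
    move=> /(_ l0) [w0 wk _]; rewrite E // E1 /h.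
    have GS : G l * s.[mu l] != 0.
      by apply: contraNneq wk => GS; rewrite -subr_eq0 E // GS mulr0.
    have G0' : G l != 0 by apply: contraNneq GS => ->; rewrite mul0r.
    have wX : mu l ^+ (k - 1) != 0 by rewrite expf_neq0.
    by field; rewrite l0 G0' wX kR0.
  - by apply: (continuousM hc); apply: continuousV => //; rewrite G0 oner_neq0.
rewrite (@remove_sing0 _ _ (fun l => l * (h l / (mu l - eps ^+ i)))) ?mul0r //.
- apply: near_neq0; apply: filterS2 near_branch_sub1 near_branch => l E1 + l0.
  move=> /(_ l0) [w0 wk _]; rewrite E // /h.
  have wX : mu l ^+ (k - 1) != 0 by rewrite expf_neq0.
  have we := prim_root_sub_neq0 epsP i wk.
  by field; rewrite l0 wX kR0 we.
apply: (@continuousM _ _ id (fun l => h l / (mu l - eps ^+ i))).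
  exact: (@cvg_id).
apply: (continuousM hc); apply: continuousV.
  by rewrite mu0 subr_eq0 eq_sym (prim_root_neq1 epsP) // ik lt0n i0.
by apply: (@continuousB _ _ _ mu (cst (eps ^+ i))) => //; exact: cst_continuous.
Qed.

(* s - den = (X - 1) t with t(1) = 0; this double zero at 1 makes
   p 0 l - 1 quadratically small, since p 0 l = s(mu l) / den(mu l). *)
Let t : {poly K} :=
  \sum_(j < k) \sum_(i < j) 'X^i - ((k%:R - 1) / 2)%:P * s.
Let den : {poly K} := k%:R%:P + ((k%:R - 1) / 2)%:P * ('X - 1%:P) * s.

Let t1 : t.[1] = 0.
Proof.
rewrite /t !hornerE s1 horner_sum.
under eq_bigr => j _.
  rewrite horner_sum; under eq_bigr do rewrite hornerXn expr1n.
  rewrite sumr_const card_ord; over.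
(* At 1 the double sum is 0 + 1 + ... + (k - 1), which equals (k - 1)/2 times s(1) = k. *)
rewrite -natr_sum -(big_mkord xpredT id) bin2_sum.
have -> : (k%:R - 1 : K) = k.-1%:R by rewrite -[in LHS](prednK k_gt0) -natr1 addrK.
apply: (@mulIf _ 2%:R); first by rewrite pnatr_eq0.
rewrite mul0r mulrBl -natrM mulrAC divfK ?pnatr_eq0 // -natrM.
by rewrite muln2 -mul2n mul_bin_left bin1 subn1 mulnC subrr.
Qed.

Let sub_s w : s.[w] - k%:R = (w - 1) * (\sum_(j < k) \sum_(i < j) 'X^i).[w].
Proof.
have -> : (k%:R : K) = \sum_(j < k) 1 by rewrite sumr_const card_ord.
rewrite sE horner_sum mulr_sumr -sumrB.
apply: eq_bigr => j _; rewrite subrX1 horner_sum; congr (_ * _).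
by apply: eq_bigr => i _; rewrite hornerXn.
Qed.

Let denW w : den.[w] = k%:R + (k%:R - 1) / 2 * (w - 1) * s.[w].
Proof. by rewrite /den !hornerE. Qed.

Lemma coef0_near_sqr_bounded : near_sqr_bounded (fun l => p 0%N l - 1).
Proof.
have /factor_theorem [r rE] : root t 1 by exact/rootP.
(* From s - den = (X - 1)^2 r and mu - 1 = l G the difference is l^2 G^2 r(mu) / den(mu); [g] is the
   cofactor of l^2. *)
pose g l := G l * G l * r.[mu l] / den.[mu l].
have den1 : den.[1] = k%:R by rewrite denW subrr mulr0 mul0r addr0.
apply: (@near_sqr_bounded_mul _ _ g); last first.
  apply: (@continuousM _ _ (fun l => G l * G l * r.[mu l])).
    by apply: (continuousM (continuousM Gc Gc)); exact: continuous_horner_comp.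
  by apply: continuousV; [rewrite mu0 den1 | exact: continuous_horner_comp].
apply: filterS3 remove_sing_coef0 near_branch near_branch_sub1 => l -> + E.
have [-> _|l0 /(_ isT) [w0 wk lE]] := eqVneq l 0.
  by rewrite G0 invr1 subrr expr0n mul0r.
have wE : mu l ^+ k - 1 = (mu l - 1) * s.[mu l] by rewrite sE subrX1.
have wk0 : mu l ^+ k - 1 != 0 by rewrite subr_eq0.
have denE : den.[mu l] = (mu l ^+ k - 1) / l.
  rewrite lE mulrDr [_ * (k%:R / _)]mulrC divfK // wE denW.
  by congr (_ + _); rewrite -mulrA mulrC.
have den0 : den.[mu l] != 0 by rewrite denE mulf_neq0 ?invr_neq0.
have G0' : G l != 0.
  by apply: contraNneq wk0 => GE; rewrite wE E GE mulr0 mul0r.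
have rM : (mu l - 1) ^+ 2 * r.[mu l] = s.[mu l] - den.[mu l].
  have tE : r.[mu l] * (mu l - 1) = t.[mu l] by rewrite rE hornerM hornerXsubC.
  rewrite expr2 -mulrA [_ * r.[_]]mulrC tE hornerD hornerN hornerM hornerC mulrBr.
  by rewrite -sub_s denW; ring.
have GV : (G l)^-1 = s.[mu l] / den.[mu l].
  rewrite denE wE E; have sl : s.[mu l] != 0.
    by apply: contraNneq wk0 => sl; rewrite wE sl mulr0.
  by field; rewrite l0 G0' sl.
rewrite GV; transitivity ((s.[mu l] - den.[mu l]) / den.[mu l]).
  by rewrite mulrBl divff.
by rewrite -rM E /g; ring.
Qed.

(** Near 0 the difference is exactly zero: the coefficient is 1/G and mu - 1 = l G. *)
Lemma coef0_mul_sub1_near_sqr_bounded :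
  near_sqr_bounded (fun l => p 0%N l * (mu l - 1) - l).
Proof.
exists 0; have Gn : \forall l \near (0 : K), G l != 0.
  by apply: continuous_near_neq => //; rewrite G0 oner_neq0.
apply: filterS3 remove_sing_coef0 near_branch_sub1 Gn => l -> -> Gl.
by rewrite mulrCA mulVf // mulr1 subrr normr0 mul0r.
Qed.

(** With e = eps^i, 1/(e mu - 1) - 1/(e - 1) = - e (mu - 1) / ((e mu - 1)(e - 1)), and mu - 1 = l G
    supplies the second factor l. *)
Lemma coef_near_sqr_bounded i : (0 < i < k)%N ->
  near_sqr_bounded (fun l => p i l - l * (eps ^+ i - 1)^-1).
Proof.
move=> ik.
pose g l := - (eps ^+ i * (eps ^+ i - 1)^-1) * (G l * (eps ^+ i * mu l - 1)^-1).
apply: (@near_sqr_bounded_mul _ _ g); last first.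
  apply: (@continuousM _ _ (cst _)); first exact: cst_continuous.
  by apply: (continuousM Gc); exact: coef_cont.
have en : \forall l \near (0 : K), eps ^+ i * mu l != 1.
  apply: continuous_near_neq; last by rewrite mu0 mulr1 (prim_root_neq1 epsP).
  by apply: (@continuousM _ _ (cst _)) => //; exact: cst_continuous.
apply: filterS2 en near_branch_sub1 => l el E.
rewrite remove_sing_coef // /g.
have {}E : G l * l = mu l - 1 by rewrite E mulrC.
transitivity (l * (- (eps ^+ i * (eps ^+ i - 1)^-1) * ((G l * l) * (eps ^+ i * mu l - 1)^-1))).
  rewrite E; move: el (prim_root_neq1 epsP ik); rewrite -!(subr_eq0 _ 1) => e1 e2.
  by field; rewrite e1 e2.
ring.
Qed.

Lemma coef_mul_sub1_near_sqr_bounded i : (0 < i < k)%N ->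
  near_sqr_bounded (fun l => p i l * (mu l - 1)).
Proof.
move=> ik; pose g l := G l * (eps ^+ i * mu l - 1)^-1.
apply: (@near_sqr_bounded_mul _ _ g); last first.
  by apply: (continuousM Gc); exact: coef_cont.
apply: filterS near_branch_sub1 => l E.
by rewrite remove_sing_coef // E /g; ring.
Qed.
End Branch.

(** * Matrices *)

Section Matrices.
Variables (K : numFieldType) (k n : nat) (eps : K).
Variables (A T : 'M[K]_n.+1) (mu : K -> K).
Hypothesis epsP : k.-primitive_root eps.
Hypothesis hA : A ^+ k = 1%:M.
Hypothesis hAT : A *m T = eps *: (T *m A).
Hypothesis hT : T ^+ k - 1%:M \in unitmx.
Hypothesis hmu : root_branch k mu.

Let k_gt0 : (0 < k)%N. Proof. exact: prim_order_gt0 epsP. Qed.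
Let mu0 : mu 0 = 1. Proof. by case: hmu. Qed.

(** [T - 1] is a factor of T^k - 1. *)
Let T1 : T - 1 \is a GRing.unit.
Proof.
move: hT; rewrite -[1%:M]/(1 : 'M[K]_n.+1) subrX1 -mulmxE unitmx_mul.
by case/andP.
Qed.

Local Notation S := (Sop k eps A T mu).
Local Notation V l x :=
  (\sum_(0 <= i < k) Qmx k eps A T mu l i *m x *m Bmx eps A T ^+ i).
Local Notation p i l := (remove_sing (fun z => z / (eps ^+ i * mu z - 1)) l).

(** Up to the scalar mu l the matrix is T - (mu l)^-1, invertible exactly when (mu l)^-1 is no root
    of [char_poly T]. This holds at l = 0 by [T1] and persists by continuity. *)
Lemma near_scale_sub1_unit :
  \forall l \near (0 : K), mu l *: T - 1 \is a GRing.unit.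
Proof.
have root_unit a : (char_poly T).[a] != 0 = (T - a%:M \in unitmx).
  rewrite -[_ == 0]/(root _ _) -eigenvalue_root_char.
  by rewrite /eigenvalue /eigenspace kermx_eq0 row_free_unit negbK.
case: hmu => _ muc _.
have mun : \forall l \near (0 : K), mu l != 0.
  by apply: continuous_near_neq => //; rewrite mu0 oner_neq0.
have : \forall l \near (0 : K), (char_poly T).[(mu l)^-1] != 0.
  apply: continuous_near_neq.
    apply: (@continuous_horner_comp _ _ (fun l => (mu l)^-1)).
    by apply: continuousV => //; rewrite mu0 oner_neq0.
  by rewrite mu0 invr1 root_unit.
apply: filterS2 mun => l mul; rewrite root_unit => TU.
have -> : mu l *: T - 1 = mu l *: (T - (mu l)^-1%:M).
  by rewrite scalerBr -scalemx1 scalerA divff // scale1r.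
change (mu l *: (T - (mu l)^-1%:M) \in unitmx).
by rewrite unitmxZ ?unitfE.
Qed.

Let Rop_twist x : Rop k eps A T x = twist_sum_deriv k eps A T x.
Proof.
rewrite /twist_sum_deriv big_ltn // expr0 subrr invr0 scale0r add0r.
congr (_ + _); apply: eq_big_nat => i /andP[_ /ltnW ik].
by rewrite (expr_subn_inv epsP hA ik).
Qed.

Let SE l x : S l x = \sum_(0 <= i < k) p i l *:
  ((mu l *: T - 1) * (T - 1)^-1 * (A ^+ (k - i) * x * Bmx eps A T ^+ i)).
Proof.
by apply: eq_bigr => i _; rewrite -!scalemxAl !mulrA.
Qed.

Let S_twist l x : l != 0 -> S l x = twist_sum k eps A T l (mu l) x.
Proof.
move=> l0; rewrite SE; apply: eq_big_nat => i /andP[_ /ltnW ik].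
by rewrite (expr_subn_inv epsP hA ik) /remove_sing (negPf l0) !mulrA.
Qed.

Let V_twist l x : l != 0 -> V l x = twist_sum_inv k eps A T l (mu l) x.
Proof.
move=> l0; apply: eq_bigr => i _.
by rewrite /Qmx /remove_sing (negPf l0) -!scalemxAl.
Qed.

Let only_first (F : nat -> 'M[K]_n.+1) : (forall i, (0 < i < k)%N -> F i = 0) ->
  \sum_(0 <= i < k) F i = F 0%N.
Proof.
move=> F0; rewrite big_ltn // big1_seq ?addr0 // => i.
by rewrite mem_index_iota; exact: F0.
Qed.

(** The identities for twisted sums assume l nonzero, so l = 0 is treated apart: only the
    coefficient at i = 0 survives there, and it is 1. *)
Let S0 x : S 0 x = x.
Proof.
rewrite SE only_first => [|i /andP[i0 ik]].
  rewrite (remove_sing_coef_at0 epsP hmu) // mu0 !scale1r mulrV //.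
  by rewrite subn0 hA !expr0 mulr1 !mul1r.
by rewrite (remove_sing_coef_at0 epsP hmu) // gtn_eqF // scale0r.
Qed.

Let V0 x : V 0 x = x.
Proof.
rewrite /Qmx only_first => [|i /andP[i0 ik]].
  rewrite (remove_sing_inv_coef_at0 epsP hmu) // mu0 mulr1 subn0.
  rewrite hA (prim_expr_order epsP) !scale1r mulmx1 mulmxV //.
  by rewrite expr0 mulmx1 mul1mx.
by rewrite (remove_sing_inv_coef_at0 epsP hmu) // gtn_eqF // scale0r !mul0mx.
Qed.

Lemma near_Sop_mul : \forall l \near (0 : K), forall X Y : 'M[K]_n.+1,
  S l X *m S l Y = S l (X *m Y + l *: circ k eps A T X Y).
Proof.
apply: filterS (near_branch epsP hmu) => l hl X Y.
have [->|l0] := eqVneq l 0; first by rewrite scale0r addr0 !S0.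
have [w0 wk lw] := hl l0.
rewrite !S_twist // /circ !Rop_twist.
exact: (twist_sum_mul epsP hA hAT T1 l0 wk lw).
Qed.

Lemma near_SopK : \forall l \near (0 : K), is_inverse (S l) (fun x => V l x).
Proof.
apply: filterS2 (near_branch epsP hmu) near_scale_sub1_unit => l hl wT.
have [->|l0] := eqVneq l 0; first by split=> x; rewrite S0 V0.
have [w0 wk lw] := hl l0.
split=> x; rewrite S_twist // V_twist //.
  exact: (twist_sumK epsP hA hAT T1 l0 wk w0 wT).
exact: (twist_sum_invK epsP hA hAT T1 l0 wk w0 wT).
Qed.

(** Since (mu T - 1)(T - 1)^-1 = 1 + (mu - 1) C, the difference is a combination of matrices
    independent of l, and four kinds of scalar coefficients remain to be bounded. *)
Lemma Sop_expansion (x : 'M[K]_n.+1) :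
  (fun l : K => S l x - (x + l *: Rop k eps A T x))
    =O_ (0 : K) (fun l : K => l ^+ 2 : K).
Proof.
apply: near_sqr_bounded_eqO.
pose C := Cmx T; pose Y i := A ^+ (k - i) * x * Bmx eps A T ^+ i.
have comb (u v s y t w : 'M[K]_n.+1) :
    u + v + s - (y + (t + w)) = u - y + (v - w) + (s - t).
  by rewrite !opprD [u - y + _]addrACA [RHS]addrACA -[- y - w - t]addrA (addrC (- w)).
pose a i l := p i l - l * (eps ^+ i - 1)^-1.
pose b i l := p i l * (mu l - 1).
have -> : (fun l => S l x - (x + l *: Rop k eps A T x)) = (fun l =>
    ((p 0%N l - 1) *: x + (b 0%N l - l) *: (C * x))
    + \sum_(i <- index_iota 1 k) (a i l *: Y i + b i l *: (C * Y i))).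
  apply/funext => l.
  have ME : (mu l *: T - 1) * (T - 1)^-1 = 1 + (mu l - 1) *: C.
    have -> : mu l *: T - 1 = (T - 1) + (mu l - 1) *: T.
      by rewrite scalerBl scale1r [RHS]addrC addrA subrK.
    by rewrite mulrDl mulrV // -scalerAl.
  rewrite SE ME big_ltn // subn0 hA expr0 mulr1 mul1r.
  rewrite /Rop scalerDr scaler_sumr.
  have -> : \sum_(1 <= i < k) (a i l *: Y i + b i l *: (C * Y i)) =
     \sum_(1 <= i < k) p i l *: ((1 + (mu l - 1) *: C) * Y i)
     - \sum_(1 <= i < k) l *: ((eps ^+ i - 1)^-1 *: Y i).
    rewrite -sumrB; apply: eq_bigr => i _.
    rewrite mulrDl mul1r -scalerAl scalerDr !scalerA addrAC.
    by rewrite /a /b scalerBl.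
  rewrite mulrDl mul1r -scalerAl scalerDr scalerA !scalerBl !scale1r.
  exact: comb.
apply: near_sqr_boundedD.
  apply: near_sqr_boundedD; apply: near_sqr_boundedZ.
    exact: (coef0_near_sqr_bounded epsP hmu).
  exact: (coef0_mul_sub1_near_sqr_bounded epsP hmu).
apply: near_sqr_bounded_sum => i; rewrite mem_index_iota => ik.
apply: near_sqr_boundedD; apply: near_sqr_boundedZ.
  exact: (coef_near_sqr_bounded epsP hmu).
exact: (coef_mul_sub1_near_sqr_bounded epsP hmu).
Qed.
End Matrices.

(** * Adjoints for the trace form, and the theorem *)

Lemma tr_mul_inj (R : pzRingType) (m n : nat) (X Y : 'M[R]_(m, n)) :
  (forall Z : 'M[R]_(n, m), \tr (Z *m X) = \tr (Z *m Y)) -> X = Y.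
Proof.
move=> XY; apply/matrixP => i j.
(* Pairing with matrix units reads off the entries. *)
have trE (Z : 'M[R]_(m, n)) : \tr (delta_mx j i *m Z) = Z i j.
  rewrite /mxtrace (bigD1 j) //= big1 ?addr0 => [|j' jj'].
    rewrite mxE (bigD1 i) //= big1 ?addr0 => [|i' ii'].
      by rewrite mxE !eqxx mul1r.
    by rewrite mxE (negPf ii') andbF mul0r.
  by rewrite mxE big1 // => i' _; rewrite mxE (negPf jj') mul0r.
by rewrite -!trE.
Qed.

(** Cyclicity of the trace shows that the reversed sum is an adjoint, and nondegeneracy of the trace
    form makes it the only one. *)
Lemma is_adjointP (K : numFieldType) (n : nat) (I : Type) (r : seq I)
    (F G : I -> 'M[K]_n) (V L : 'M[K]_n -> 'M[K]_n) :
  (forall x, V x = \sum_(i <- r) F i *m x *m G i) ->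
  is_adjoint V L <-> (forall x, L x = \sum_(i <- r) G i *m x *m F i).
Proof.
move=> VE.
have adj x y : \tr (V x *m y) = \tr (x *m \sum_(i <- r) G i *m y *m F i).
  rewrite VE mulmx_suml mulmx_sumr !raddf_sum; apply: eq_bigr => i _ /=.
  by rewrite -!mulmxA mxtrace_mulC !mulmxA.
split=> [VL x|LE x y]; last by rewrite adj LE.
by apply: tr_mul_inj => z; rewrite -VL adj.
Qed.

Theorem proposition1 (R : realType) (k n : nat) (eps : Cx R)
    (A T : 'M[Cx R]_n) (mu : Cx R -> Cx R)
    (hk : (0 < k)%N) (hn : (0 < n)%N)
    (heps : eps = cexp (0 +i* (2 * pi / k%:R)))
    (hA : A ^+ k = 1%:M)
    (hAT : A *m T = eps *: (T *m A))
    (hT : T ^+ k - 1%:M \in unitmx)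
    (hmu : root_branch k mu) :
  let B := Bmx eps A T in
  let Rx := Rop k eps A T in
  let S := Sop k eps A T mu in
  let Q := Qmx k eps A T mu in
  [/\ (forall x : 'M[Cx R]_n,
         (fun l : Cx R => S l x - (x + l *: Rx x))
           =O_ (0 : Cx R) (fun l : Cx R => l ^+ 2 : Cx R)),
      (\forall l \near (0 : Cx R), forall X Y : 'M[Cx R]_n,
         S l X *m S l Y = S l (X *m Y + l *: circ k eps A T X Y)),
      (\forall l \near (0 : Cx R), forall V : 'M[Cx R]_n -> 'M[Cx R]_n,
         is_inverse (S l) V <->
         (forall x, V x = \sum_(0 <= i < k) Q l i *m x *m B ^+ i)) &
      (\forall l \near (0 : Cx R), forall V L : 'M[Cx R]_n -> 'M[Cx R]_n,
         is_inverse (S l) V ->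
         (is_adjoint V L <->
          (forall x, L x = \sum_(0 <= i < k) B ^+ i *m x *m Q l i)))].
Proof.
have epsP : k.-primitive_root eps by rewrite heps; exact: cexp_primitive_root.
case: n hn A T hA hAT hT => // n _ A T hA hAT hT B Rx S Q.
have SK := near_SopK epsP hA hAT hT hmu.
(* Uniqueness of two-sided inverses turns the explicit inverse into a characterization of every
   inverse [V]. *)
have uniq_inverse l V W : is_inverse (S l) V -> is_inverse (S l) W -> V =1 W.
  by move=> [SV VS] [SW WS] x; rewrite -{1}(WS x) SV.
split.
- exact: Sop_expansion.
- exact: near_Sop_mul.
- apply: filterS SK => l SV V; split=> [SV'|VE]; first exact: uniq_inverse SV' SV.
  by have -> : V = fun x => \sum_(0 <= i < k) Q l i *m x *m B ^+ i by apply/funext.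
- apply: filterS SK => l SV V L SV'; apply: is_adjointP.
  exact: uniq_inverse SV' SV.
Qed.
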